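(* Let $\sigma = \textrm{Prop} \cup \mathbb{A}$ be a modal signature with $\mathbb{A} = \{R_i \mid i \in I\}$, $I$ finite. Let $M_a$ and $N_b$ be degree-finite $\sigma$-LTSs. Then $\textrm{hom}_{\mathbb{N}}(\mathcal{A}^k_\sigma,M_a) = \textrm{hom}_{\mathbb{N}}(\mathcal{A}^k_\sigma,N_b)$ if and only if $M_a$ and $N_b$ satisfy the same formulas of $\textrm{ML}^{B,k}_{\#}$ over $\sigma$.
   Context: A $\sigma$-LTS is a structure over a modal signature $\sigma$ (finitely many unary proposition letters and binary actions $R_i$) with one distinguished element; degree-finite means each state has finitely many successors and predecessors. Graded modal logic $\textrm{ML}_{\#}$ extends basic modal logic with graded modalities $\Diamond_i^{\geq k}$ ($k\geq 1$): $\Diamond_i^{\geq k}\varphi$ holds at a state iff at least $k$ of its $R_i$-successors satisfy $\varphi$. A backward modality, written here $\Diamond^{-,\geq k}_i$ (a ''black diamond'' in the paper), holds at $a$ iff at least $k$ elements $b$ with $R_i^M(b,a)$ satisfy $\varphi$. $\textrm{ML}^{B}_{\#}$ is $\textrm{ML}_{\#}$ extended with all backward modalities $\Diamond^{-,\geq k}_i$, and $\textrm{ML}^{B,k}_{\#}$ is its fragment of modal depth at most $k$. $\mathcal{A}^k_\sigma$ is the class of finite connected acyclic $\sigma$-LTSs of depth at most $k$. $\textrm{hom}_{\mathbb{N}}(\mathcal{C},M_a)$ is the vector indexed by $\mathcal{C}$ whose entry at $T_c$ is the number of homomorphisms from $T_c$ to $M_a$ mapping $c$ to $a$. *)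

(* Defs.v *)
From mathcomp Require Import all_boot finmap.
From mathcomp Require Import mathcomp_extra boolp classical_sets functions cardinality.

Set Implicit Arguments.
Unset Strict Implicit.
Unset Printing Implicit Defensive.

Local Open Scope classical_set_scope.
Local Open Scope card_scope.

Record signature := Signature {
  prop_letter : finType;
  action : finType
}.

Record LTS (sigma : signature) := MkLTS {
  state :> Type;
  holds : prop_letter sigma -> state -> Prop;
  trans : action sigma -> state -> state -> Prop;
  point : state
}.

Arguments MkLTS {sigma state} holds trans point.
Arguments holds {sigma} l p x.
Arguments trans {sigma} l i x y.
Arguments point {sigma} l.

Section Structures.
Variable sigma : signature.
Implicit Types M N T : LTS sigma.

Definition degree_finite M : Prop :=
  forall x : M,
    finite_set [set y : M | exists i, trans M i x y] /\
    finite_set [set y : M | exists i, trans M i y x].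

Definition adjacent M (x y : M) : Prop :=
  exists i, trans M i x y \/ trans M i y x.

Fixpoint walk M (n : nat) (x y : M) : Prop :=
  if n is n'.+1 then exists z, adjacent x z /\ walk n' z y else x = y.

Definition connected M : Prop := forall x y : M, exists n, walk n x y.

(* Binary facts R_i(x, y) are encoded as triples (i, x, y). *)
Definition fact M : Type := (action sigma * M * M)%type.

Definition fact_joins M (f : fact M) (u v : M) : Prop :=
  let: (i, x, y) := f in
  trans M i x y /\ ((x = u /\ y = v) \/ (x = v /\ y = u)).

(* A cycle of the undirected multigraph with one edge per binary fact:
   [n.+1] distinct states joined cyclically ([ordS] is the cyclic successor)
   by [n.+1] distinct facts. Thus a loop R_i(x, x) is a cycle ([n = 0]), and so
   are two distinct facts on the same two states ([n = 1]), such as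
   R_i(x, y), R_j(x, y) with i <> j, or R_i(x, y), R_j(y, x). This is
   acyclicity of the incidence multigraph. *)
Definition acyclic M : Prop :=
  ~ exists (n : nat) (v : 'I_n.+1 -> M) (e : 'I_n.+1 -> fact M),
      [/\ injective v, injective e &
          forall j, fact_joins (e j) (v j) (v (ordS j))].

(* Depth is the largest undirected distance from the distinguished state. *)
Definition depth_at_most M (k : nat) : Prop :=
  forall x : M, exists2 n, n <= k & walk n (point M) x.

Definition class_A (k : nat) (T : LTS sigma) : Prop :=
  [/\ finite_set [set: T], connected T, acyclic T & depth_at_most T k].

Definition is_hom T M (h : T -> M) : Prop :=
  [/\ forall p x, holds T p x -> holds M p (h x),
      forall i x y, trans T i x y -> trans M i (h x) (h y) &
      h (point T) = point M].

(* [fset_set] is the empty set on infinite sets; the set of homomorphisms is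
   finite when [T] is finite and connected and [M] is degree-finite. *)
Definition hom_count T M : nat :=
  #|` fset_set [set h : {classic (T -> M)} | is_hom h]|%fset.

Definition hom_vector (C : LTS sigma -> Prop) M : {T : LTS sigma | C T} -> nat :=
  fun t => hom_count (sval t) M.

(* [Dia i n phi] and [BDia i n phi] stand for the graded modalities with
   threshold [n.+1], as thresholds are at least 1. *)
Inductive formula : Type :=
| Letter of prop_letter sigma
| Top
| Neg of formula
| And of formula & formula
| Dia of action sigma & nat & formula
| BDia of action sigma & nat & formula.

Fixpoint modal_depth (phi : formula) : nat :=
  match phi with
  | Letter _ | Top => 0
  | Neg psi => modal_depth psi
  | And psi chi => maxn (modal_depth psi) (modal_depth chi)
  | Dia _ _ psi | BDia _ _ psi => (modal_depth psi).+1
  end.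

Fixpoint sat M (x : M) (phi : formula) : Prop :=
  match phi with
  | Letter p => holds M p x
  | Top => True
  | Neg psi => ~ sat x psi
  | And psi chi => sat x psi /\ sat x chi
  | Dia i n psi => `I_n.+1 #<= [set y : M | trans M i x y /\ sat y psi]
  | BDia i n psi => `I_n.+1 #<= [set y : M | trans M i y x /\ sat y psi]
  end.

Definition same_formulas (k : nat) M N : Prop :=
  forall phi : formula, modal_depth phi <= k ->
    (sat (point M) phi <-> sat (point N) phi).

End Structures.

Arguments hom_vector {sigma} C M _.
Arguments class_A {sigma} k T.

(* Main.v *)
(** Write a k-theory of a state for the set of formulas of depth at most k that it
    satisfies, and a k-profile for the vector of numbers of homomorphisms sending
    the root of a tree of depth at most k to it.

    Equal k-theories give equal counts: graded modalities count the neighbours of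
    a state with a given (k-1)-theory, so between the neighbours of two states with
    the same k-theory there are theory-preserving injections. A structure in
    [class_A k] is a tree rooted at its distinguished state, hence pushing a
    homomorphism into M along such injections, level by level, yields an injection
    from the homomorphisms into M to those into N.

    Equal k-profiles give equal theories: trees of depth k-1 are closed under gluing
    at the root, which multiplies counts, and attaching an edge above the root turns
    counts into sums over neighbours. As distinct multiplicative functions are
    linearly independent, states with equal k-profiles have, for each (k-1)-profile,
    as many neighbours with that profile, and induction on formulas applies. *)

From mathcomp Require Import all_boot finmap ssralg ssrint.
From mathcomp Require Import mathcomp_extra boolp classical_sets functions cardinality.
Require Import Defs.

Set Implicit Arguments.
Unset Strict Implicit.
Unset Printing Implicit Defensive.

Local Open Scope classical_set_scope.
Local Open Scope card_scope.

(** * Neighbours and theories *)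

Lemma card_seq (T : choiceType) (s : seq T) : uniq s -> [set` s] #= `I_(size s).
Proof.
move=> us; have -> : [set` s] = [set` [fset x in s]%fset].
  by apply/seteqP; split=> x /=; rewrite !inE.
by apply/card_eq_fsetP; rewrite card_fseq undup_id.
Qed.

Lemma card_ge_seq (T : choiceType) (s : seq T) (n : nat) :
  uniq s -> (`I_n #<= [set` s]) = (n <= size s).
Proof. by move=> /card_seq us; rewrite (card_le_eqr us) card_le_II. Qed.

(** Within each fibre, the element of [s] at a given position goes to the element of [r] at the same
    position, which exists by the count hypothesis. [b0] only serves as the default of [nth]. *)
Lemma fiber_injection (A B C : eqType) (b0 : B) (f : A -> C) (g : B -> C)
    (s : seq A) (r : seq B) :
  uniq r ->
  (forall a, a \in s ->
     count (fun x => f x == f a) s <= count (fun y => g y == f a) r) ->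
  exists2 pi : A -> B, {in s &, injective pi} &
    forall a, a \in s -> pi a \in r /\ g (pi a) = f a.
Proof.
move=> ur le_sr.
pose sf c := [seq x <- s | f x == c]; pose rf c := [seq y <- r | g y == c].
pose pi a := nth b0 (rf (f a)) (index a (sf (f a))).
have lt_index a : a \in s -> index a (sf (f a)) < size (rf (f a)).
  move=> sa; apply: leq_trans (_ : size (sf (f a)) <= _).
    by rewrite index_mem mem_filter eqxx.
  by rewrite !size_filter le_sr.
have pi_rf a : a \in s -> pi a \in rf (f a) by move=> sa; rewrite mem_nth ?lt_index.
exists pi => [a a' sa sa' pi_eq|a sa]; last first.
  by move: (pi_rf a sa); rewrite mem_filter => /andP[/eqP].
have fE : f a = f a'.
  move: (pi_rf a sa) (pi_rf a' sa'); rewrite !mem_filter pi_eq.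
  by move=> /andP[/eqP <- _] /andP[/eqP <-].
move: pi_eq; rewrite /pi fE => /eqP.
have := lt_index a sa; rewrite fE => lt_a.
rewrite nth_uniq ?lt_index ?filter_uniq// => /eqP.
by apply: (index_inj a); rewrite mem_filter ?fE eqxx.
Qed.

Section Neighbours.
Variable sigma : signature.
Implicit Types (M N L : LTS sigma) (phi psi : formula sigma).
Implicit Types (i : action sigma) (b : bool).

(* Facts read from either end: forwards if [b] is true, backwards otherwise. *)
Definition edge M i b (x y : M) : Prop :=
  if b then trans M i x y else trans M i y x.

(** A duplicate-free list, so that neighbours can be counted and summed over. It has the intended
    meaning under degree-finiteness, since [fset_set] is empty on infinite sets. *)
Definition nbrs M i b (x : M) : seq {classic M} :=
  fset_set [set y : {classic M} | edge i b x y].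

Lemma uniq_nbrs M i b (x : M) : uniq (nbrs i b x).
Proof. exact: fset_uniq. Qed.

Lemma mem_nbrs M i b (x : M) (y : {classic M}) :
  degree_finite M -> (y \in nbrs i b x) = `[< edge i b x y >].
Proof.
move=> hM; rewrite in_fset_set; first by [].
have [out inn] := hM x.
by case: b; [apply: sub_finite_set out|apply: sub_finite_set inn] => z; exists i.
Qed.

Definition GDia i b n psi := if b then Dia i n psi else BDia i n psi.

Lemma depth_GDia i b n psi : modal_depth (GDia i b n psi) = (modal_depth psi).+1.
Proof. by case: b. Qed.

Definition satb M psi (y : {classic M}) : bool := `[< sat (y : M) psi >].

Lemma sat_GDia M i b n psi (x : M) : degree_finite M ->
  sat x (GDia i b n psi) <-> n < count (satb psi) (nbrs i b x).
Proof.
move=> hM; rewrite -size_filter -card_ge_seq ?filter_uniq ?uniq_nbrs//.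
have -> : sat x (GDia i b n psi) =
    (`I_n.+1 #<= [set y : M | edge i b x y /\ sat y psi]).
  by case: b.
suff -> : [set y : M | edge i b x y /\ sat y psi] =
    [set` [seq y <- nbrs i b x | satb psi y]] by [].
apply/seteqP; split=> y /=; rewrite mem_filter mem_nbrs//.
  by move=> [xy sy]; apply/andP; split; apply/asboolP.
by move=> /andP[/asboolP sy /asboolP].
Qed.

Definition theory M (j : nat) (x : M) : formula sigma -> Prop :=
  fun phi => modal_depth phi <= j /\ sat x phi.

Lemma theory_sat M N j (x : M) (y : N) phi : theory j x = theory j y ->
  modal_depth phi <= j -> sat x phi <-> sat y phi.
Proof.
move=> e dphi; have := congr1 (@^~ phi) e; rewrite /theory => e'.
split=> s; first by have [] : modal_depth phi <= j /\ sat y phi by rewrite -e'.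
by have [] : modal_depth phi <= j /\ sat x phi by rewrite e'.
Qed.

Lemma sat_theory M N j (x : M) (y : N) :
  (forall phi, modal_depth phi <= j -> sat x phi <-> sat y phi) ->
  theory j x = theory j y.
Proof.
move=> h; apply/funext => phi; apply/propext.
by split=> -[dphi s]; split=> //; apply/(h phi dphi).
Qed.

(** Thresholds are unbounded, so a theory need not be captured by one formula. Against a finite list
    it is: take the conjunction of one distinguishing formula for each state whose theory differs
    from that of [a]. *)
Lemma separating_formula L N j (a : L) (s : seq {classic N}) :
  exists chi, [/\ modal_depth chi <= j, sat a chi &
    forall z : {classic N}, z \in s -> sat (z : N) chi ->
      theory j (z : N) = theory j a].
Proof.
elim: s => [|z s [chi [dchi achi IH]]]; first by exists (Top sigma).
have [za|za] := pselect (theory j (z : N) = theory j a).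
  by exists chi; split=> // w; rewrite inE => /orP[/eqP ->|/IH].
have [psi [dpsi apsi zpsi]] : exists psi,
    [/\ modal_depth psi <= j, sat a psi & ~ sat (z : N) psi].
  apply: contrapT => no; apply/za/sat_theory => phi dphi.
  split=> [sz|sa]; apply: contrapT => nsat; apply: no.
    by exists (Neg phi); split => // /(_ sz).
  by exists phi.
exists (And psi chi); split => /=; first by rewrite geq_max dpsi.
  by [].
by move=> w; rewrite inE => /orP[/eqP ->|/IH h] [].
Qed.

Lemma theory_injection M N j i b (x : M) (y : N) :
  degree_finite M -> degree_finite N -> theory j.+1 x = theory j.+1 y ->
  exists2 pi : {classic M} -> {classic N}, {in nbrs i b x &, injective pi} &
    forall z, z \in nbrs i b x ->
      pi z \in nbrs i b y /\ theory j (pi z : N) = theory j (z : M).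
Proof.
move=> hM hN xy.
pose C : eqType := {classic (formula sigma -> Prop)}.
have [|pi inj_pi pi_nbrs] := @fiber_injection {classic M} {classic N} C (point N)
  (fun z => theory j (z : M)) (fun z => theory j (z : N))
  (nbrs i b x) (nbrs i b y) (uniq_nbrs i b y); last by exists pi.
move=> a _.
(* The conjunction [chi] singles out the theory of [a] among the neighbours of both [x] and [y], so
   counting a theory becomes counting a formula. *)
have [chi1 [d1 a1 sep1]] := separating_formula j (a : M) (nbrs i b x).
have [chi2 [d2 a2 sep2]] := separating_formula j (a : M) (nbrs i b y).
pose chi := And chi1 chi2.
have dchi : modal_depth chi <= j by rewrite /= geq_max d1.
have achi : sat (a : M) chi by [].
have cM : count (fun z : {classic M} => (theory j (z : M) : C) == theory j (a : M))
    (nbrs i b x) = count (@satb M chi) (nbrs i b x).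
  apply: eq_in_count => z xz /=; apply/eqP/asboolP => [e|[s1 _]]; last exact: sep1.
  exact/(theory_sat e dchi).
have cN : count (fun z : {classic N} => (theory j (z : N) : C) == theory j (a : M))
    (nbrs i b y) = count (@satb N chi) (nbrs i b y).
  apply: eq_in_count => z yz /=; apply/eqP/asboolP => [e|[_ s2]]; last exact: sep2.
  exact/(theory_sat e dchi).
rewrite cM cN leqNgt; apply/negP => lt_c.
(* Index n in [GDia] means threshold n+1: this formula asks for one more neighbour than [y] has, yet
   it holds at [x] by [lt_c]. *)
have /(theory_sat xy) : modal_depth
    (GDia i b (count (@satb N chi) (nbrs i b y)) chi) <= j.+1.
  by rewrite depth_GDia.
by move/(sat_GDia _ _ _ _ _ hM): lt_c => s [/(_ s) /sat_GDia -/(_ hN)]; rewrite ltnn.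
Qed.

End Neighbours.

(** * Acyclic structures as rooted trees *)

Section RelWalk.
Variables (T : Type) (R : T -> T -> Prop).

(** Walks along an arbitrary relation, so that the same lemmas cover adjacency and adjacency with
    one fact removed. *)
Fixpoint rel_walk (n : nat) (x y : T) : Prop :=
  if n is n'.+1 then exists z, R x z /\ rel_walk n' z y else x = y.

Lemma rel_walk_cat m n x y z :
  rel_walk m x y -> rel_walk n y z -> rel_walk (m + n) x z.
Proof.
elim: m x => [|m IH] x /=; first by move->.
by move=> [w [xw wy]] yz; exists w; split=> //; apply: IH yz.
Qed.

Lemma rel_walk1 x y : R x y -> rel_walk 1 x y.
Proof. by move=> xy; exists y. Qed.

Lemma rel_walk_last n x y :
  rel_walk n.+1 x y -> exists z, rel_walk n x z /\ R z y.
Proof.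
elim: n x => [|n IH] x [z [xz /=]]; first by move=> <-; exists x.
by move=> /IH[w [zw wy]]; exists w; split=> //; exists z.
Qed.

Lemma rel_walk_sym n x y : (forall u v, R u v -> R v u) ->
  rel_walk n x y -> rel_walk n y x.
Proof.
move=> symR; elim: n x y => [|n IH] x y; first by move=> /= ->.
move=> /= [z [/symR/rel_walk1 zx /IH yz]].
by have := rel_walk_cat yz zx; rewrite addn1.
Qed.

Lemma rel_walk_fun n x y : rel_walk n x y ->
  exists w : nat -> T, [/\ w 0 = x, w n = y & forall j, j < n -> R (w j) (w j.+1)].
Proof.
elim: n x => [|n IH] x /=; first by move=> ->; exists (fun=> y).
move=> [z [xz /IH[w [w0 wn wR]]]].
exists (fun j => if j is j'.+1 then w j' else x); split=> //.
by case=> [|j] lt_jn; [rewrite w0|apply: wR].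
Qed.

Lemma rel_walk_segment (w : nat -> T) n a m :
  (forall j, j < n -> R (w j) (w j.+1)) -> a + m <= n ->
  rel_walk m (w a) (w (a + m)).
Proof.
move=> wR; elim: m a => [|m IH] a le_n; first by rewrite /= addn0.
exists (w a.+1); split; last by rewrite addnS -addSn; apply: IH; rewrite addSn -addnS.
by apply: wR; apply: leq_trans le_n; rewrite addnS ltnS leq_addr.
Qed.

(** A walk of minimal length repeats no state, since the segment between two visits could be cut
    out. *)
Lemma rel_walk_simple n x y : rel_walk n x y ->
  exists m (w : nat -> T), [/\ w 0 = x, w m = y,
    (forall j, j < m -> R (w j) (w j.+1)) &
    forall a b, a <= m -> b <= m -> w a = w b -> a = b].
Proof.
move=> wn; have ex_n : exists n, `[< rel_walk n x y >] by exists n; apply/asboolP.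
case: (ex_minnP ex_n) => m /asboolP wm min_m.
have [w [w0 wE wR]] := rel_walk_fun wm.
exists m, w; split=> //.
suff no_rep a b : a < b -> b <= m -> w a <> w b.
  move=> a b am bm wab; case: (ltngtP a b) => // ltab.
    by case: (no_rep a b ltab bm).
  by case: (no_rep b a ltab am).
move=> ltab bm wab.
have wa : rel_walk a x (w a).
  by rewrite -w0; apply: (rel_walk_segment wR); rewrite add0n (leq_trans (ltnW ltab)).
have wb : rel_walk (m - b) (w a) y.
  by rewrite wab -wE -{2}(subnKC bm); apply: (rel_walk_segment wR); rewrite subnKC.
have /min_m : `[< rel_walk (a + (m - b)) x y >].
  by apply/asboolP; apply: rel_walk_cat wa wb.
by rewrite leqNgt -{2}(subnKC bm) ltn_add2r ltab.
Qed.

End RelWalk.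

(** * Bridges, distances and parents in acyclic structures *)

Section Acyclic.
Variables (sigma : signature) (T : LTS sigma).
Implicit Types (e f : fact T) (u v x y p : T).

Lemma walkE n x y : walk n x y = rel_walk (@adjacent sigma T) n x y.
Proof. by elim: n x => //= n IH x; congr (ex _); apply/funext => z; rewrite IH. Qed.

Lemma adjacent_sym u v : adjacent u v -> adjacent v u.
Proof. by move=> [i [h|h]]; exists i; [right|left]. Qed.

Lemma fact_joins_sym e u v : fact_joins e u v -> fact_joins e v u.
Proof. by case: e => [[i x] y] [t [?|?]]; split=> //; [right|left]. Qed.

Lemma fact_joins_adjacent e u v : fact_joins e u v -> adjacent u v.
Proof. by case: e => [[i x] y] [t [[<- <-]|[<- <-]]]; exists i; [left|right]. Qed.

Lemma adjacent_fact_joins u v : adjacent u v -> exists e, fact_joins e u v.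
Proof.
move=> [i [t|t]]; first by exists (i, u, v); split=> //; left.
by exists (i, v, u); split=> //; right.
Qed.

Lemma fact_joins_ends e u v x y : fact_joins e u v -> fact_joins e x y ->
  (u = x /\ v = y) \/ (u = y /\ v = x).
Proof.
case: e => [[i a] b] [_ [[<- <-]|[<- <-]]] [_ [[<- <-]|[<- <-]]];
  by [left|right].
Qed.

Definition joined_avoiding e u v : Prop := exists2 f, f <> e & fact_joins f u v.

Lemma joined_avoiding_sym e u v : joined_avoiding e u v -> joined_avoiding e v u.
Proof. by move=> [f fe /fact_joins_sym]; exists f. Qed.

(** Every fact is a bridge: a simple walk between its ends that avoids it would close up with it to
    a cycle. A loop is the case of a walk of length 0. *)
Lemma acyclic_bridge e n u v : acyclic T -> fact_joins e u v ->
  ~ rel_walk (joined_avoiding e) n u v.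
Proof.
move=> acT euv wuv; have [m [w [w0 wm wR wI]]] := rel_walk_simple wuv; apply: acT.
have /choice[f fP] : forall j, exists f, j < m -> f <> e /\ fact_joins f (w j) (w j.+1).
  move=> j; have [ltjm|_] := boolP (j < m); last by exists e.
  by have [f fe fj] := wR j ltjm; exists f.
(* The [m] steps of the walk use facts other than [e]; the last index [m] receives [e], leading from
   [w m] back to [w 0]. *)
exists m, (fun j : 'I_m.+1 => w j), (fun j : 'I_m.+1 => if j < m then f j else e).
split=> [a b /wI wab|a b|j].
- by apply/val_inj/wab; rewrite -ltnS.
(* A fact used at two steps has the same ends there. Matching them crosswise would force both a =
   b+1 and a+1 = b. *)
- case: ifPn => am; case: ifPn => bm fab; apply/val_inj => /=.
  + have [_ ja] := fP a am; have [_ jb] := fP b bm.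
    rewrite fab in ja; have [[/wI wab _]|[/wI wab1 /wI wab2]] := fact_joins_ends ja jb.
      by apply: wab; apply: ltnW.
    have e1 := wab1 (ltnW am) bm; have e2 := wab2 am (ltnW bm).
    by move: e2; rewrite e1 => /eqP; rewrite -[X in _ == X]addn0 -addn2 eqn_add2l.
  + by have [/(_ fab)] := fP a am.
  + by have [/(_ (esym fab))] := fP b bm.
  + have eqm (c : 'I_m.+1) : ~~ (c < m) -> val c = m.
      by move=> cm; apply/eqP; rewrite eqn_leq -ltnS ltn_ord leqNgt.
    by rewrite [LHS]eqm ?[RHS]eqm.
- rewrite /=; have [jm|jm] := ltnP j m; first by rewrite modn_small//; have [] := fP j jm.
  have -> : (j : nat) = m by apply/eqP; rewrite eqn_leq -ltnS ltn_ord.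
  by rewrite modnn wm w0; apply: fact_joins_sym.
Qed.

(** A presentation as a rooted tree: [uplink x] gives label, direction and parent for the fact
    leading from [x] towards the root, with direction true when that fact points away from the root.
    By [trans_uplink] there are no other facts. *)
Record rooting := Rooting {
  level : T -> nat;
  uplink : T -> option (action sigma * bool * T);
  level_walk : forall n x, walk n (point T) x -> level x <= n;
  uplink_None : forall x, uplink x = None -> x = point T;
  uplink_Some : forall x i b p, uplink x = Some (i, b, p) ->
    edge i b p x /\ level x = (level p).+1;
  trans_uplink : forall i x y, trans T i x y ->
    uplink y = Some (i, true, x) \/ uplink x = Some (i, false, y) }.

Section Levels.
Variable d : T -> nat.
Hypotheses (d_walk : forall x, walk (d x) (point T) x)
  (d_min : forall n x, walk n (point T) x -> d x <= n).

Lemma dist_point : d (point T) = 0.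
Proof. by apply/eqP; rewrite -leqn0; apply: d_min. Qed.

Lemma dist_joined e x y : fact_joins e x y -> d y <= (d x).+1.
Proof.
move=> exy; have xy := rel_walk1 (fact_joins_adjacent exy); apply: d_min; rewrite walkE.
by rewrite -addn1; apply: rel_walk_cat xy; rewrite -walkE.
Qed.

Lemma dist_parent x : x <> point T -> exists p e, fact_joins e p x /\ d x = (d p).+1.
Proof.
move=> x0; have := d_walk x; case E : (d x) => [|n]; first by move/esym.
rewrite walkE => wx; have [p [wp px]] := rel_walk_last wx.
have [e ep] := adjacent_fact_joins px.
exists p, e; split=> //; apply/eqP; rewrite eqn_leq -{1}E (dist_joined ep).
by rewrite ltnS d_min// walkE.
Qed.

(** Passing repeatedly to a parent reaches the root using only facts whose outer end is no farther
    away than [x]. *)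
Lemma descend_avoiding e x :
  (forall f u v, fact_joins f u v -> d v = (d u).+1 -> d v <= d x -> f <> e) ->
  exists n, rel_walk (joined_avoiding e) n x (point T).
Proof.
move Em : (d x) => m; elim: m x Em => [|m IH] x Ex avoid.
  by exists 0; have := d_walk x; rewrite Ex /= => ->.
have [x0|x0] := pselect (x = point T); first by move: Ex; rewrite x0 dist_point.
have [p [f [fpx Exp]]] := dist_parent x0.
have Ep : d p = m by move: Exp; rewrite Ex => -[].
have [g u v guv Ev le_v|n wn] := IH p Ep; first exact: avoid guv Ev (leqW le_v).
exists n.+1, p; split=> //; exists f; last exact: fact_joins_sym.
by apply: avoid fpx Exp _; rewrite Ex.
Qed.

Lemma joined_via_point e x y n m :
  rel_walk (joined_avoiding e) n x (point T) ->
  rel_walk (joined_avoiding e) m y (point T) ->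
  rel_walk (joined_avoiding e) (n + m) x y.
Proof.
move=> xp yp; apply: rel_walk_cat xp _.
by apply: rel_walk_sym yp => u v; apply: joined_avoiding_sym.
Qed.

Hypothesis acT : acyclic T.

(** If the distances agreed, [e] would be no parent fact, so the descents from [x] and [y] to the
    root would join its ends without it, contradicting that it is a bridge. *)
Lemma dist_neq e x y : fact_joins e x y -> d x <> d y.
Proof.
move=> exy dxy.
have avoid f u v : fact_joins f u v -> d v = (d u).+1 -> f <> e.
  move=> fuv Ev fe; rewrite fe in fuv.
  have [[eu ev]|[eu ev]] := fact_joins_ends fuv exy; move: Ev;
    by rewrite eu ev dxy => /n_Sn.
have [n xn] : exists n, rel_walk (joined_avoiding e) n x (point T).
  by apply: descend_avoiding => f u v fuv Ev _; apply: avoid fuv Ev.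
have [m ym] : exists n, rel_walk (joined_avoiding e) n y (point T).
  by apply: descend_avoiding => f u v fuv Ev _; apply: avoid fuv Ev.
exact: acyclic_bridge acT exy (joined_via_point xn ym).
Qed.

(** The descents from [p] and [q] stay closer to the root than [x], hence avoid [e]. If [f] differed
    from [e], going from [p] through the root to [q] and along [f] to [x] would bypass the bridge
    [e]. *)
Lemma parent_fact_unique e f x p q : fact_joins e p x -> fact_joins f q x ->
  d x = (d p).+1 -> d x = (d q).+1 -> e = f.
Proof.
move=> epx fqx Ep Eq; apply: contrapT => ef.
have avoid r : d r < d x -> exists n, rel_walk (joined_avoiding e) n r (point T).
  move=> rx; apply: descend_avoiding => g u v guv Ev le_v ge.
  rewrite ge in guv; have [[eu ev]|[eu ev]] := fact_joins_ends guv epx.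
    by move: (leq_ltn_trans le_v rx); rewrite ev ltnn.
  by move: Ev; rewrite eu ev Ep => /eqP; rewrite -[X in X == _]addn0 -addn2 eqn_add2l.
have [n pn] : exists n, rel_walk (joined_avoiding e) n p (point T).
  by apply: avoid; rewrite Ep.
have [m qm] : exists n, rel_walk (joined_avoiding e) n q (point T).
  by apply: avoid; rewrite Eq.
apply: (acyclic_bridge acT epx); apply: rel_walk_cat (joined_via_point pn qm) _.
by apply: rel_walk1; exists f => // /esym.
Qed.

Lemma rooting_of_dist : inhabited rooting.
Proof.
have /choice[up upP] x : exists o : option (action sigma * bool * T),
    if o is Some (i, b, p) then edge i b p x /\ d x = (d p).+1 else x = point T.
  have [x0|x0] := pselect (x = point T); first by exists None.
  have [p [[[i u] v] [[t uv] Ex]]] := dist_parent x0.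
  case: uv t => [[-> ->]|[-> ->]] t; first by exists (Some (i, true, p)).
  by exists (Some (i, false, p)).
have upE i b x y : edge i b x y -> d y = (d x).+1 -> up y = Some (i, b, x).
  move=> xy Ey; have := upP y; case: (up y) => [[[j c] p]|y0]; last first.
    by move: Ey; rewrite y0 dist_point.
  move=> [py Ep].
  (* Uniqueness holds for facts as triples; equal triples give equal label and parent, and opposite
     directions would make [y] its own parent. *)
  pose mk k (a : bool) (z : T) : fact T := if a then (k, z, y) else (k, y, z).
  have mkP k a z : edge k a z y -> fact_joins (mk k a z) z y.
    by case: a => t; split=> //; [left|right].
  have := parent_fact_unique (mkP _ _ _ xy) (mkP _ _ _ py) Ey Ep.
  have neq z : d y = (d z).+1 -> z <> y.
    by move=> + zy; rewrite zy => /n_Sn.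
  rewrite /mk; case: (b); case: (c) => -[-> //].
  - by move=> ->.
  - by move=> /(neq x Ey).
  - by move=> /esym/(neq p Ep).
  - by move=> ->.
constructor; apply: (@Rooting d up) => //.
- by move=> x Ex; have := upP x; rewrite Ex.
- by move=> x i b p Ex; have := upP x; rewrite Ex.
- move=> i x y t; have xy : fact_joins (i, x, y) x y by split=> //; left.
  have := dist_neq xy; have := dist_joined xy; have := dist_joined (fact_joins_sym xy).
  case: (ltngtP (d x) (d y)) => // lt_xy yx xy' _.
    by left; apply: upE => //; apply/eqP; rewrite eqn_leq xy' lt_xy.
  by right; apply: upE => //; apply/eqP; rewrite eqn_leq yx lt_xy.
Qed.

End Levels.

Lemma acyclic_rooting : connected T -> acyclic T -> inhabited rooting.
Proof.
move=> cT acT.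
have /choice[d dP] x : exists n, walk n (point T) x /\
    forall m, walk m (point T) x -> n <= m.
  have ex_n : exists n, `[< walk n (point T) x >].
    by have [n wn] := cT (point T) x; exists n; apply/asboolP.
  case: (ex_minnP ex_n) => n /asboolP wn min_n.
  by exists n; split=> // m wm; apply/min_n/asboolP.
by apply: (@rooting_of_dist d) => // [x|n x]; have [] := dP x => // _; apply.
Qed.

End Acyclic.

(** * Transporting homomorphisms *)

Lemma finite_bounded_functions (T U : Type) (B : set U) :
  finite_set [set: T] -> finite_set B ->
  finite_set [set h : T -> U | forall x, B (h x)].
Proof.
move=> /(finite_seqP (T := {classic T}))[s sT] /(finite_seqP (T := {classic U}))[r rB].
(* A function with values in [B] is determined by the positions in [r] of its values along [s]. The
   successor keeps the ordinal type inhabited, as [inord] requires. *)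
pose code (h : T -> U) : {ffun 'I_(size s) -> 'I_(size r).+1} :=
  [ffun j => inord (index (h (tnth (in_tuple s) j) : {classic U}) r)].
rewrite -(eq_finite_set (inj_card_eq (f := code) _)) ?finite_finset//.
move=> h1 h2 /set_mem h1B /set_mem h2B /ffunP eq_code; apply/funext => x.
have sx : (x : {classic T}) \in s by have : [set: T] x by []; rewrite sT.
have lt_x : index (x : {classic T}) s < size s by rewrite index_mem.
have tx : tnth (in_tuple s) (Ordinal lt_x) = x.
  by rewrite (tnth_nth (x : {classic T}))/= nth_index.
have := eq_code (Ordinal lt_x); rewrite !ffunE tx.
have rh (h : T -> U) : B (h x) -> (h x : {classic U}) \in r by rewrite rB.
move=> /(congr1 val); rewrite /= !inordK ?ltnS ?index_size//.
by apply: (index_inj (h1 x : {classic U})); apply: rh.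
Qed.

Section Homs.
Variable sigma : signature.
Implicit Types (M N T : LTS sigma).

Lemma finite_walk N n (x : N) : degree_finite N -> finite_set [set y | walk n x y].
Proof.
move=> hN; elim: n x => [|n IH] x /=.
  by apply: sub_finite_set (finite_set1 x) => y /= ->.
have fin : finite_set [set z : N | adjacent x z].
  have [out inn] := hN x.
  have : finite_set ([set z : N | exists i, trans N i x z] `|`
     [set z : N | exists i, trans N i z x]) by rewrite finite_setU.
  by apply: sub_finite_set => z [i [t|t]]; [left|right]; exists i.
apply: sub_finite_set (bigcup_finite fin (fun z _ => IH z)).
by move=> y [z [xz zy]]; exists z.
Qed.

Lemma walk_map T N (h : T -> N) n (x y : T) :
  (forall i u v, trans T i u v -> trans N i (h u) (h v)) ->
  walk n x y -> walk n (h x) (h y).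
Proof.
move=> hT; elim: n x => [|n IH] x /=; first by move->.
move=> [z [[i t] zy]]; exists (h z); split; last exact: IH.
by exists i; case: t => t; [left|right]; apply: hT.
Qed.

(** Homomorphisms preserve walks, so all values lie in the ball of radius [k] around [point N],
    which is finite. *)
Lemma finite_homs T N k : class_A k T -> degree_finite N ->
  finite_set [set h : T -> N | is_hom h].
Proof.
move=> [fT _ _ dT] hN.
have fB : finite_set (\bigcup_(n in `I_k.+1) [set y : N | walk n (point N) y]).
  by apply: bigcup_finite => // n _; apply: finite_walk.
apply: sub_finite_set (finite_bounded_functions fT fB) => h hh x.
have [n le_nk wx] := dT x; exists n => //=.
by have [_ hT <-] := hh; apply: walk_map.
Qed.

Lemma hom_count_le T M N k : class_A k T -> degree_finite M -> degree_finite N ->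
  same_formulas k M N -> hom_count T M <= hom_count T N.
Proof.
move=> AT hM hN /sat_theory th_k.
have [fT cT acT dT] := AT; have [rt] := acyclic_rooting cT acT.
(* One injection is fixed for each depth, label, direction and pair of states, so that equal parent
   data always select the same injection. If the theories differ, an arbitrary constant map is
   used. *)
have /choice[pi piP] : forall q : nat * action sigma * bool * M * N,
    exists pi : {classic M} -> {classic N}, let: (j, i, b, x, y) := q in
    theory j.+1 x = theory j.+1 y ->
    {in nbrs i b x &, injective pi} /\
    forall z, z \in nbrs i b x ->
      pi z \in nbrs i b y /\ theory j (pi z : N) = theory j (z : M).
  move=> [[[[j i] b] x] y].
  have [xy|nxy] := pselect (theory j.+1 x = theory j.+1 y).
    by have [pi ? ?] := theory_injection i b hM hN xy; exists pi.
  by exists (fun=> point N).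
(* The recursion is on [n], to be taken as the level of [x]. At level 0 the value [point N] is the
   correct image of the root; a state at level [n] will keep its theory of depth [k - n]. *)
pose push := fix push (h : T -> M) (n : nat) (x : T) : N :=
  if n is n'.+1 then
    if uplink rt x is Some (i, b, p) then
      pi (k - n, i, b, h p, push h n' p) (h x)
    else point N
  else point N.
pose F (h : T -> M) : T -> N := fun x => push h (level rt x) x.
have level_k x : level rt x <= k.
  by have [n le_nk wn] := dT x; apply: leq_trans le_nk; apply: level_walk.
have F_up h x i b p : uplink rt x = Some (i, b, p) ->
    F h x = pi (k - level rt x, i, b, h p, F h p) (h x).
  move=> up; have [_ Ex] := uplink_Some up.
  by rewrite /F Ex /= up.
have k_level x p : level rt x = (level rt p).+1 ->
    k - level rt p = (k - level rt x).+1.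
  by move=> E; rewrite E subnSK// -E.
have up_edge (h : T -> M) x i b p : is_hom h -> uplink rt x = Some (i, b, p) ->
    (h x : {classic M}) \in nbrs i b (h p).
  move=> [_ hT _] /uplink_Some[e _]; rewrite mem_nbrs//; apply/asboolP.
  by case: b e => e; apply: hT.
have level_ind (P : T -> Prop) : P (point T) ->
    (forall x i b p, uplink rt x = Some (i, b, p) -> P p -> P x) -> forall x, P x.
  move=> P0 PS x; move En : (level rt x) => n; elim: n x En => [|n IH] x Ex.
    case up : (uplink rt x) => [[[i b] p]|]; last by rewrite (uplink_None up).
    by have [_] := uplink_Some up; rewrite Ex.
  case up : (uplink rt x) => [[[i b] p]|]; last by rewrite (uplink_None up).
  apply: (PS _ _ _ _ up); apply: IH; have [_] := uplink_Some up.
  by rewrite Ex => -[].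
have level0 : level rt (point T) = 0.
  by apply/eqP; rewrite -leqn0; apply: level_walk.
have F0 h : F h (point T) = point N by rewrite /F level0.
have F_theory h : is_hom h -> forall x,
    theory (k - level rt x) (h x) = theory (k - level rt x) (F h x).
  move=> hh; elim/level_ind => [|x i b p up].
    by rewrite level0 subn0 F0; have [_ _ ->] := hh.
  have [_ Ex] := uplink_Some up; rewrite (k_level _ _ Ex) (F_up _ _ _ _ _ up) => IHp.
  by have [_ /(_ _ (up_edge _ _ _ _ _ hh up))[_ ->]] := piP (_, i, b, _, _) IHp.
have F_edge h x i b p : is_hom h -> uplink rt x = Some (i, b, p) ->
    edge i b (F h p) (F h x).
  move=> hh up; have [_ Ex] := uplink_Some up.
  have thp := F_theory h hh p; rewrite (k_level _ _ Ex) in thp.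
  have [_ /(_ _ (up_edge _ _ _ _ _ hh up))[+ _]] := piP (_, i, b, _, _) thp.
  by rewrite mem_nbrs// -(F_up h _ _ _ _ up) => /asboolP.
have F_hom h : is_hom h -> is_hom (F h).
  move=> hh; split=> // [q x Tq|i x y t]; last first.
    by have [/F_edge|/F_edge] := trans_uplink rt t; apply.
  have [hq _ _] := hh.
  have s : sat (h x) (Letter q) by apply: hq.
  exact: (theory_sat (F_theory h hh x) (leq0n _ : modal_depth (Letter q) <= _)).1.
(* Induction away from the root: once [h1] and [h2] agree at the parent, the same injection is
   applied to their values at the child. *)
have F_inj h1 h2 : is_hom h1 -> is_hom h2 -> F h1 = F h2 -> h1 = h2.
  move=> hh1 hh2 EF; apply/funext; elim/level_ind => [|x i b p up Ep].
    by have [_ _ ->] := hh1; have [_ _ ->] := hh2.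
  have [_ Ex] := uplink_Some up.
  have thp := F_theory h1 hh1 p; rewrite (k_level _ _ Ex) in thp.
  have [inj _] := piP (_, i, b, _, _) thp.
  apply: inj; first exact: up_edge.
    by rewrite Ep; apply: up_edge.
  by rewrite -(F_up _ _ _ _ _ up) Ep EF -(F_up _ _ _ _ _ up).
pose HM := fset_set [set h : {classic (T -> M)} | is_hom (h : T -> M)].
pose HN := fset_set [set h : {classic (T -> N)} | is_hom (h : T -> N)].
pose FC (h : {classic (T -> M)}) : {classic (T -> N)} := F h.
have memM h : h \in HM -> is_hom (h : T -> M).
  by rewrite in_fset_set => [/set_mem|]; [|exact: (finite_homs AT hM)].
have inj : {in HM &, injective FC} by move=> h1 h2 /memM h1P /memM h2P; apply: F_inj.
rewrite /hom_count -/HM -/HN -(card_in_imfset imfset_key inj).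
apply: fsubset_leq_card; apply/fsubsetP => _ /imfsetP[h /memM hP ->].
rewrite in_fset_set; last exact: (finite_homs AT hN).
by apply/mem_set/F_hom.
Qed.

End Homs.

(** * Homomorphism profiles *)

Section Moments.
Import GRing.Theory.
Local Open Scope ring_scope.
Variable I : Type.
Implicit Types (p a : {classic (I -> nat)}) (ws : seq (I * nat)).

Definition vanisher ws p : int := \prod_(w <- ws) ((p w.1)%:Z - w.2%:Z).

(** As in Lagrange interpolation, each [q] in [s] other than [a] contributes a factor that vanishes
    at [q], taken at an argument where [q] and [a] differ. *)
Lemma vanisher_exists a (s : seq {classic (I -> nat)}) :
  exists2 ws, vanisher ws a != 0 & forall p, p \in s -> p != a -> vanisher ws p = 0.
Proof.
elim: s => [|q s [ws wa ws0]]; first by exists [::]; rewrite // /vanisher big_nil.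
have [->|qa] := eqVneq q a.
  exists ws => // p; rewrite inE => /orP[/eqP ->|]; [by rewrite eqxx|exact: ws0].
have [t tqa] : exists t, q t <> a t.
  apply: contrapT => no; move/eqP: qa; apply; apply/funext => t.
  by apply: contrapT => tqa; apply: no; exists t.
exists ((t, q t) :: ws) => [|p]; rewrite /vanisher big_cons.
  by rewrite mulf_neq0 ?subr_eq0//=; apply/eqP => -[/esym].
rewrite inE => /orP[/eqP ->|sp pa]; first by rewrite subrr mul0r.
by rewrite [X in _ * X]ws0 ?mulr0.
Qed.

(* Independence of characters, for natural-number combinations: a finite
   multiset of multiplicative functions is determined by its sums. *)
Lemma perm_eq_multiplicative (one : I) (mul : I -> I -> I)
    (A B : seq {classic (I -> nat)}) :
  (forall p, p \in A ++ B -> p one = 1%N /\ forall s t, p (mul s t) = (p s * p t)%N) ->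
  (forall t, \sum_(p <- A) p t = \sum_(p <- B) p t)%N ->
  perm_eq A B.
Proof.
move=> mulAB sumAB; apply/allP => /= a _; apply/eqP.
have [ws wa ws0] := vanisher_exists a (A ++ B).
(* Multiplicativity absorbs each factor: p(t)(p(s) - c) = p([mul t s]) - c p(t), so the equality of
   sums survives weighting by any vanisher. *)
have sum_ws us t : \sum_(p <- A) (p t)%:Z * vanisher us p =
    \sum_(p <- B) (p t)%:Z * vanisher us p.
  elim: us t => [|[s c] us IH] t.
    under eq_bigr do rewrite /vanisher big_nil mulr1.
    under [RHS]eq_bigr do rewrite /vanisher big_nil mulr1.
    by have /(congr1 Posz) := sumAB t; rewrite !(big_morph Posz PoszD (erefl 0)).
  have step (D : seq {classic (I -> nat)}) : {subset D <= A ++ B} ->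
      \sum_(p <- D) (p t)%:Z * vanisher ((s, c) :: us) p =
      \sum_(p <- D) (p (mul t s))%:Z * vanisher us p -
      c%:Z * \sum_(p <- D) (p t)%:Z * vanisher us p.
    move=> DAB; rewrite mulr_sumr -sumrB; apply: eq_big_seq => p /DAB/mulAB[_ pM].
    rewrite /vanisher big_cons /= pM PoszM mulrBl mulrBr !mulrA.
    by rewrite [c%:Z * _]mulrC.
  rewrite !step ?IH// => p pD; rewrite mem_cat pD ?orbT//.
(* At [one] only the occurrences of [a] survive, so cancelling the nonzero value [vanisher ws a]
   leaves equal multiplicities in [A] and [B]. *)
have sum_one (D : seq {classic (I -> nat)}) : {subset D <= A ++ B} ->
    \sum_(p <- D) (p one)%:Z * vanisher ws p = vanisher ws a * (count_mem a D)%:Z.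
  move=> DAB; transitivity (\sum_(p <- D) vanisher ws a * (p == a)%:Z); last first.
    rewrite -mulr_sumr -sum1_count (big_morph Posz PoszD (erefl 0))/=.
    by congr (_ * _); rewrite [RHS]big_mkcond; apply: eq_bigr => p _; case: (p == a).
  apply: eq_big_seq => p /DAB pAB; have [-> _] := mulAB p pAB; rewrite mul1r.
  by have [->|pa] := eqVneq p a; rewrite ?mulr1// mulr0 ws0.
have := sum_ws ws one; rewrite !sum_one => [/(mulfI wa)[]//|p pD|p pD];
  by rewrite mem_cat pD ?orbT.
Qed.

End Moments.

(** * Tree terms, their counts and profiles *)

Section Trees.
Variable sigma : signature.
Implicit Types (M N : LTS sigma) (i j : action sigma) (b c : bool).

(* Rooted trees in binary form: [Graft i b t1 t2] is [t2] with [t1] attached as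
   one more child of the root, along an [i]-edge directed away from the root if
   and only if [b] is true. *)
Inductive tree : Type :=
| Leaf of {set prop_letter sigma}
| Graft of action sigma & bool & tree & tree.

Fixpoint tree_depth (t : tree) : nat :=
  match t with
  | Leaf _ => 0
  | Graft _ _ t1 t2 => maxn (tree_depth t1).+1 (tree_depth t2)
  end.

(** The number of homomorphisms sending the root to [x]: the grafted child may go to any suitable
    neighbour, independently of the rest. *)
Fixpoint tree_count M (t : tree) (x : M) : nat :=
  match t with
  | Leaf P => `[< forall p, p \in P -> holds M p x >]
  | Graft i b t1 t2 => (\sum_(y <- nbrs i b x) tree_count t1 (y : M)) * tree_count t2 x
  end.

Fixpoint add_letters (P : {set prop_letter sigma}) (t : tree) : tree :=
  match t with
  | Leaf Q => Leaf (P :|: Q)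
  | Graft i b t1 t2 => Graft i b t1 (add_letters P t2)
  end.

(** Gluing at the roots: the children are put together and the letters of the two roots united. *)
Fixpoint tree_mul (s t : tree) : tree :=
  match s with
  | Leaf P => add_letters P t
  | Graft i b s1 s2 => Graft i b s1 (tree_mul s2 t)
  end.

Lemma depth_add_letters P t : tree_depth (add_letters P t) = tree_depth t.
Proof. by elim: t => //= i b t1 _ t2 ->. Qed.

Lemma depth_tree_mul s t : tree_depth (tree_mul s t) = maxn (tree_depth s) (tree_depth t).
Proof.
elim: s => [P|i b s1 _ s2 IH] /=; first by rewrite depth_add_letters max0n.
by rewrite IH maxnA.
Qed.

Lemma tree_count_add_letters M P t (x : M) :
  tree_count (add_letters P t) x = tree_count (Leaf P) x * tree_count t x.
Proof.
elim: t => [Q|i b t1 _ t2 IH] /=; last by rewrite IH /= mulnCA.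
rewrite mulnb; congr (nat_of_bool _); apply/asboolP/andP => [h|[/asboolP hP /asboolP hQ] p].
  by split; apply/asboolP => p pP; apply: h; rewrite inE pP ?orbT.
by rewrite inE => /orP[/hP|/hQ].
Qed.

Lemma tree_count_mul M s t (x : M) :
  tree_count (tree_mul s t) x = tree_count s x * tree_count t x.
Proof.
elim: s => [P|i b s1 _ s2 IH] /=; first exact: tree_count_add_letters.
by rewrite IH mulnA.
Qed.

Lemma tree_count_Leaf0 M (x : M) : tree_count (Leaf finset.set0) x = 1.
Proof. by rewrite /= asboolT// => p; rewrite inE. Qed.

Definition profile M k (x : M) : {t : tree | tree_depth t <= k} -> nat :=
  fun t => tree_count (sval t) x.

Global Arguments profile {M} k x _.

Lemma profile_injection M N k i b (x : M) (y : N) :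
  profile k.+1 x = profile k.+1 y ->
  exists2 pi : {classic M} -> {classic N}, {in nbrs i b x &, injective pi} &
    forall z, z \in nbrs i b x ->
      pi z \in nbrs i b y /\ profile k (pi z : N) = profile k (z : M).
Proof.
move=> xy; pose I := {t : tree | tree_depth t <= k}.
pose C : eqType := {classic (I -> nat)}.
pose pM (z : {classic M}) : C := profile k (z : M).
pose pN (z : {classic N}) : C := profile k (z : N).
have [|pi inj_pi pi_nbrs] := @fiber_injection {classic M} {classic N} C (point N)
  pM pN (nbrs i b x) (nbrs i b y) (uniq_nbrs i b y); last by exists pi.
pose one : I := exist _ (Leaf finset.set0) (leq0n k).
have mul_depth (s t : I) : tree_depth (tree_mul (sval s) (sval t)) <= k.
  by rewrite depth_tree_mul geq_max (svalP s) (svalP t).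
pose mul (s t : I) : I := exist _ (tree_mul (sval s) (sval t)) (mul_depth s t).
have /permP permMN : perm_eq (map pM (nbrs i b x)) (map pN (nbrs i b y)).
  apply: (@perm_eq_multiplicative I one mul) => [p|t].
    rewrite mem_cat => /orP[] /mapP[z _ ->]; split;
      by [exact: tree_count_Leaf0|move=> s t; exact: tree_count_mul].
  rewrite !big_map.
  (* A letterless root with [t] as its only child: its count is the sum of the counts of [t] over
     the neighbours. *)
  have dt : tree_depth (Graft i b (sval t) (Leaf finset.set0)) <= k.+1.
    by rewrite /= maxn0 ltnS (svalP t).
  have countE (L : LTS sigma) (z : L) : tree_count (Graft i b (sval t) (Leaf finset.set0)) z =
      \sum_(w <- nbrs i b z) tree_count (sval t) (w : L).
    by rewrite -[RHS]muln1 -(tree_count_Leaf0 z).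
  rewrite /pM /pN /profile -!countE.
  exact: (congr1 (fun p => p (exist _ (Graft i b (sval t) (Leaf finset.set0)) dt)) xy).
by move=> a _; have := permMN (pred1 (pM a)); rewrite !count_map => ->.
Qed.

Lemma GDia_injection M N i b n (psi : formula sigma) (x : M) (y : N)
    (pi : {classic M} -> {classic N}) :
  degree_finite M -> degree_finite N -> {in nbrs i b x &, injective pi} ->
  (forall z, z \in nbrs i b x ->
     pi z \in nbrs i b y /\ (sat (z : M) psi -> sat (pi z : N) psi)) ->
  sat x (GDia i b n psi) -> sat y (GDia i b n psi).
Proof.
move=> hM hN inj_pi pi_nbrs; rewrite !sat_GDia// => /leq_trans; apply.
rewrite -!size_filter -(size_map pi); apply: uniq_leq_size.
  rewrite map_inj_in_uniq ?filter_uniq ?uniq_nbrs// => u v.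
  by rewrite !mem_filter => /andP[_ ?] /andP[_ ?]; apply: inj_pi.
move=> _ /mapP[z + ->]; rewrite !mem_filter => /andP[/asboolP sz /pi_nbrs[-> sat_pi]].
by rewrite andbT; apply/asboolP/sat_pi.
Qed.

Lemma profile_sat (phi : formula sigma) M N k (x : M) (y : N) :
  degree_finite M -> degree_finite N -> modal_depth phi <= k ->
  profile k x = profile k y -> sat x phi -> sat y phi.
Proof.
elim: phi M N k x y => [p||phi IH|phi IH1 psi IH2|i n phi IH|i n phi IH] M N k x y hM hN /=.
- move=> _ xy xp; have /= := congr1 (@^~ (exist _ (Leaf [set p]%SET) (leq0n k))) xy.
  rewrite /profile/= asboolT => [|q]; last by rewrite inE => /eqP ->.
  by case: asboolP => // h _; apply: h; rewrite inE.
- by [].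
(* Negation exchanges the two structures, which is why the induction hypothesis quantifies over
   both. *)
- by move=> d xy nx sy; apply: nx; apply: IH sy; eauto.
- by rewrite geq_max => /andP[d1 d2] xy [s1 s2]; split; [apply: IH1 s1|apply: IH2 s2]; eauto.
- case: k => // k d xy; have [pi inj_pi piP] := profile_injection i true xy.
  apply: (GDia_injection (b := true) (n := n) hM hN inj_pi) => z /piP[-> e].
  by split=> //; apply: (IH _ _ k).
- case: k => // k d xy; have [pi inj_pi piP] := profile_injection i false xy.
  apply: (GDia_injection (b := false) (n := n) hM hN inj_pi) => z /piP[-> e].
  by split=> //; apply: (IH _ _ k).
Qed.
End Trees.

(** * Trees as acyclic structures *)

Section Realization.
Variable sigma : signature.
Implicit Types (M : LTS sigma) (t : tree sigma) (i j : action sigma) (b c : bool).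

Lemma fact_joins_edge M (e : fact M) (p x : M) : fact_joins e p x ->
  exists i b, edge i b p x /\ e = if b then (i, p, x) else (i, x, p).
Proof.
case: e => [[i u] v] [t [[eu ev]|[eu ev]]]; rewrite eu ev in t *.
  by exists i, true.
by exists i, false.
Qed.

(* On a cycle, a state of maximal level would have two downward facts. *)
Lemma acyclic_of_levels M (d : M -> nat) :
  (forall i x y, trans M i x y -> d y = (d x).+1 \/ d x = (d y).+1) ->
  (forall i j b c x p q, edge i b p x -> edge j c q x ->
     d x = (d p).+1 -> d x = (d q).+1 -> [/\ i = j, b = c & p = q]) ->
  acyclic M.
Proof.
move=> d_trans d_uniq [n [v [e [injv inje joins]]]].
have d_joins f x y : fact_joins f x y -> d y = (d x).+1 \/ d x = (d y).+1.
  case: f => [[i u] w] [/d_trans t [[eu ew]|[eu ew]]]; rewrite -eu -ew //.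
  by case: t => t; [right|left].
pose m := [arg max_(l > ord0) d (v l)].
have max_m l : d (v l) <= d (v m) by rewrite /m; case: arg_maxnP => // m' _; apply.
have down f x : fact_joins f x (v m) -> d x <= d (v m) -> d (v m) = (d x).+1.
  by move=> /d_joins[//|->]; rewrite ltnn.
have jS := fact_joins_sym (joins m).
have jP := joins (ord_pred m); rewrite ord_predK in jP.
have dS := down _ _ jS (max_m _); have dP := down _ _ jP (max_m _).
have [i [b [eS fS]]] := fact_joins_edge jS.
have [j [c [eP fP]]] := fact_joins_edge jP.
have [ij bc vSP] := d_uniq _ _ _ _ _ _ _ eS eP dS dP.
(* The facts before and after the maximal state coincide, so the cycle is a loop, along which the
   level cannot change. *)
have /inje mm : e m = e (ord_pred m) by rewrite fS fP ij bc vSP.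
by move: dP; rewrite -mm => /n_Sn.
Qed.

Fixpoint tree_state t : finType :=
  match t with
  | Leaf _ => unit
  | Graft _ _ t1 t2 => (tree_state t1 + tree_state t2)%type
  end.

Fixpoint tree_root t : tree_state t :=
  match t with
  | Leaf _ => tt
  | Graft _ _ _ t2 => inr (tree_root t2)
  end.

Fixpoint tree_holds t (p : prop_letter sigma) : tree_state t -> Prop :=
  match t with
  | Leaf P => fun _ => p \in P
  | Graft _ _ t1 t2 => fun x =>
      match x with inl u => tree_holds p u | inr v => tree_holds p v end
  end.

Fixpoint tree_trans t (j : action sigma) : tree_state t -> tree_state t -> Prop :=
  match t with
  | Leaf _ => fun _ _ => False
  | Graft i b t1 t2 => fun x y =>
      match x, y with
      | inl u, inl v => tree_trans j u v
      | inr u, inr v => tree_trans j u v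
      | inr u, inl v => [/\ b = true, j = i, u = tree_root t2 & v = tree_root t1]
      | inl u, inr v => [/\ b = false, j = i, u = tree_root t1 & v = tree_root t2]
      end
  end.

Definition tree_lts t : LTS sigma :=
  MkLTS (@tree_holds t) (@tree_trans t) (tree_root t).

Fixpoint tree_level t : tree_state t -> nat :=
  match t with
  | Leaf _ => fun _ => 0
  | Graft _ _ t1 t2 => fun x =>
      match x with inl u => (tree_level u).+1 | inr v => tree_level v end
  end.

Lemma tree_level_root t : tree_level (tree_root t) = 0.
Proof. by elim: t. Qed.

Lemma tree_level_depth t (x : tree_state t) : tree_level x <= tree_depth t.
Proof.
elim: t x => [P|i b t1 IH1 t2 IH2] //= [u|v]; rewrite leq_max ?ltnS ?IH1 ?IH2 ?orbT//.
Qed.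

Lemma tree_level_trans t j (x y : tree_state t) : tree_trans j x y ->
  tree_level y = (tree_level x).+1 \/ tree_level x = (tree_level y).+1.
Proof.
elim: t x y => [P|i b t1 IH1 t2 IH2] //= [u|u] [v|v].
- by move=> /IH1[->|->]; [left|right].
- by move=> [_ _ -> ->]; right; rewrite !tree_level_root.
- by move=> [_ _ -> ->]; left; rewrite !tree_level_root.
- exact: IH2.
Qed.

Section GraftEdges.
Variables (a : action sigma) (d : bool) (t1 t2 : tree sigma).
Let T := tree_lts (Graft a d t1 t2).

Lemma edge_inl i b (u v : tree_lts t1) :
  edge i b (inl u : T) (inl v) = edge i b u v.
Proof. by case: b. Qed.

Lemma edge_inr i b (u v : tree_lts t2) :
  edge i b (inr u : T) (inr v) = edge i b u v.
Proof. by case: b. Qed.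

Lemma edge_down i b (u : tree_state t2) (v : tree_state t1) :
  edge i b (inr u : T) (inl v) ->
  [/\ i = a, b = d, u = tree_root t2 & v = tree_root t1].
Proof. by case: b => -[]. Qed.

Lemma edge_up i b (u : tree_state t1) (v : tree_state t2) :
  edge i b (inl u : T) (inr v) -> v = tree_root t2.
Proof. by case: b => -[]. Qed.

End GraftEdges.

(** Only the grafting fact crosses between the two parts. It is the sole parent fact of the root of
    [t1], and the root of [t2], at level 0, has no parent. *)
Lemma tree_edge_unique t i j b c (x p q : tree_lts t) :
  edge i b p x -> edge j c q x ->
  tree_level x = (tree_level p).+1 -> tree_level x = (tree_level q).+1 ->
  [/\ i = j, b = c & p = q].
Proof.
elim: t x p q => [P|a d t1 IH1 t2 IH2] x p q; first by case: b.
have no_up (u : tree_state t1) (v : tree_state t2) l e n :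
    edge (M := tree_lts (Graft a d t1 t2)) l e (inl u) (inr v) -> tree_level v <> n.+1.
  by move=> /edge_up ->; rewrite tree_level_root.
have no_deep (u : tree_state t2) (v w : tree_state t1) l e :
    edge (M := tree_lts (Graft a d t1 t2)) l e (inr u) (inl v) ->
    (tree_level v).+1 <> (tree_level w).+2.
  by move=> /edge_down[_ _ _ ->]; rewrite tree_level_root.
case: x => x; case: p => p; case: q => q.
- rewrite !edge_inl => px qx [Ep] [Eq].
  by have [-> -> ->] := IH1 _ _ _ px qx Ep Eq.
- by move=> _ /no_deep/[apply].
- by move=> /no_deep + _ _ => /[apply].
- by move=> /edge_down[-> -> -> _] /edge_down[-> -> -> _].
- by move=> /no_up + _ => /[apply].
- by move=> /no_up + _ => /[apply].
- by move=> _ /no_up + _ => /[apply].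
- rewrite !edge_inr => px qx Ep Eq.
  by have [-> -> ->] := IH2 _ _ _ px qx Ep Eq.
Qed.

Lemma tree_level_walk t (x : tree_lts t) : walk (tree_level x) (point (tree_lts t)) x.
Proof.
elim: t x => [P|i b t1 IH1 t2 IH2] /=; first by case.
case=> [u|v] /=; last exact: (@walk_map _ (tree_lts t2) (tree_lts (Graft i b t1 t2)) inr).
exists (inl (tree_root t1)); split.
  by exists i; case: (b); [left|right].
exact: (@walk_map _ (tree_lts t1) (tree_lts (Graft i b t1 t2)) inl).
Qed.

Lemma tree_class_A t k : tree_depth t <= k -> class_A k (tree_lts t).
Proof.
move=> tk; split.
- exact: (@finite_finset (tree_state t)).
- move=> x y; exists (tree_level x + tree_level y); rewrite walkE.
  apply: (@rel_walk_cat _ _ _ _ _ (point (tree_lts t))); rewrite -?walkE.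
    rewrite walkE; apply: rel_walk_sym; first exact: adjacent_sym.
    by rewrite -walkE; apply: tree_level_walk.
  exact: tree_level_walk.
- apply: (@acyclic_of_levels (tree_lts t) (@tree_level t)).
    exact: tree_level_trans.
  exact: tree_edge_unique.
- move=> x; exists (tree_level x); last exact: tree_level_walk.
  exact: leq_trans (tree_level_depth x) tk.
Qed.

(** * Enumeration of the homomorphisms from a tree *)

Definition glue (S T U : Type) (g : S -> U) (h : T -> U) : S + T -> U :=
  fun x => match x with inl u => g u | inr v => h v end.

(** The list follows the recursion of [tree_count], so that its size is that number; the leaf case
    has one copy or none. *)
Fixpoint tree_homs M t (x : M) : seq {classic (tree_state t -> M)} :=
  match t return seq {classic (tree_state t -> M)} with
  | Leaf P => nseq `[< forall p, p \in P -> holds M p x >] (fun=> x)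
  | Graft i b t1 t2 =>
      [seq (glue h1 h2 : {classic (tree_state t1 + tree_state t2 -> M)}) |
        h1 <- [seq h | y <- nbrs i b x, h <- tree_homs t1 (y : M)],
        h2 <- tree_homs t2 x]
  end.

Lemma size_tree_homs M t (x : M) : size (tree_homs t x) = tree_count t x.
Proof.
elim: t x => [P|i b t1 IH1 t2 IH2] x /=; first by rewrite size_nseq.
rewrite size_allpairs IH2 size_allpairs_dep sumnE big_map.
by congr (_ * _); apply: eq_bigr => y _; apply: IH1.
Qed.

Definition is_hom_at M t (x : M) (h : tree_state t -> M) : Prop :=
  [/\ forall p u, tree_holds p u -> holds M p (h u),
      forall i u v, tree_trans i u v -> trans M i (h u) (h v) &
      h (tree_root t) = x].

Lemma mem_tree_homs M t (x : M) (h : {classic (tree_state t -> M)}) :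
  degree_finite M -> h \in tree_homs t x <-> is_hom_at x (h : tree_state t -> M).
Proof.
move=> hM; elim: t x h => [P|i b t1 IH1 t2 IH2] x h.
  rewrite /= mem_nseq lt0b; split=> [/andP[/asboolP hP /eqP ->]|[hP _ <-]].
    by split=> // p u; apply: hP.
  apply/andP; split; first by apply/asboolP => p pP; apply: hP.
  by apply/eqP/funext => u; case: u.
have homsP := @allpairsP {classic (tree_state t1 -> M)} {classic (tree_state t2 -> M)}
  {classic (tree_state t1 + tree_state t2 -> M)}.
have homs1P := @allpairsPdep {classic M} (fun=> {classic (tree_state t1 -> M)})
  {classic (tree_state t1 -> M)}.
split=> [|[hol tr rt]].
  move=> /homsP[[h1 h2] /= [/homs1P[y [h1' [xy h1y ->]]] h2x ->]].
  have [hol1 tr1 rt1] := (IH1 y h1').1 h1y; have [hol2 tr2 rt2] := (IH2 x h2).1 h2x.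
  move: xy; rewrite mem_nbrs// => /asboolP xy.
  split=> [p [u|v]|j [u|u] [v|v]|] //=; first exact: hol1.
  - exact: hol2.
  - exact: tr1.
  - by move=> [eb -> -> ->]; rewrite rt1 rt2; move: xy; rewrite eb.
  - by move=> [eb -> -> ->]; rewrite rt1 rt2; move: xy; rewrite eb.
  - exact: tr2.
pose h1 : {classic (tree_state t1 -> M)} := fun u => h (inl u).
pose h2 : {classic (tree_state t2 -> M)} := fun v => h (inr v).
have -> : h = glue h1 h2 by apply/funext => w; case: w.
apply/homsP; exists (h1, h2); split=> //=; last first.
  by apply/IH2; split=> // [p v|j u v]; [exact: (hol p (inr v))|exact: (tr j (inr u) (inr v))].
apply/homs1P; exists (h1 (tree_root t1)), h1; split=> //.
  rewrite mem_nbrs//; apply/asboolP; rewrite -rt.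
  have /= := tr i (inl (tree_root t1)) (inr (tree_root t2)).
  have /= := tr i (inr (tree_root t2)) (inl (tree_root t1)).
  by case: (b) => down up; [apply: down|apply: up].
by apply/IH1; split=> // [p v|j u v]; [exact: (hol p (inl v))|exact: (tr j (inl u) (inl v))].
Qed.

(** No homomorphism is listed for two different neighbours, because the neighbour is recovered as
    the image of the root of [t1]. *)
Lemma uniq_tree_homs M t (x : M) : degree_finite M -> uniq (tree_homs t x).
Proof.
move=> hM; elim: t x => [P|i b t1 IH1 t2 IH2] x; first by rewrite /=; case: asbool.
apply: (@allpairs_uniq {classic (tree_state t1 -> M)} {classic (tree_state t2 -> M)}
  {classic (tree_state t1 + tree_state t2 -> M)}); last 1 first.
- move=> [g1 g2] [h1 h2] _ _ /= e; congr pair; apply/funext => u.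
    by have := congr1 (fun h : _ -> M => h (inl u)) e.
  by have := congr1 (fun h : _ -> M => h (inr u)) e.
- apply: (@allpairs_uniq_dep {classic M} (fun=> {classic (tree_state t1 -> M)})
    {classic (tree_state t1 -> M)}) => [|y _|]; [exact: uniq_nbrs|exact: IH1|].
  have homsP := @allpairsPdep {classic M} (fun=> {classic (tree_state t1 -> M)})
    {y : {classic M} & {classic (tree_state t1 -> M)}}.
  move=> u v /homsP[y [h [_ hy ->]]] /homsP[z [g [_ gz ->]]] /= e.
  have [_ _ hr] := (mem_tree_homs y h hM).1 hy.
  have [_ _ gr] := (mem_tree_homs z g hM).1 gz.
  by move: hr gr; rewrite e => -> ->.
- exact: IH2.
Qed.

Lemma tree_hom_count M t : degree_finite M ->
  hom_count (tree_lts t) M = tree_count t (point M).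
Proof.
move=> hM; rewrite -size_tree_homs /hom_count.
have -> : [set h : {classic (tree_lts t -> M)} | is_hom (h : tree_lts t -> M)] =
    [set` tree_homs t (point M)].
  by apply/seteqP; split=> h /= hh; apply/mem_tree_homs.
exact/card_fset_set/card_seq/uniq_tree_homs.
Qed.

End Realization.

Theorem theorem4p13 (sigma : signature) (k : nat) (M N : LTS sigma)
    (hM : degree_finite M) (hN : degree_finite N) :
  hom_vector (class_A k) M = hom_vector (class_A k) N <->
  same_formulas k M N.
Proof.
split=> [homMN phi dphi|thMN].
  (* The entries of the vector at the structures [tree_lts t] already form the profile. *)
  have prof : profile k (point M) = profile k (point N).
    apply/funext => -[t tk]; rewrite /profile /= -!tree_hom_count//.
    exact: (congr1 (fun v => v (exist _ (tree_lts t) (tree_class_A tk))) homMN).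
  by split; [apply: profile_sat dphi prof|apply: profile_sat dphi (esym prof)].
apply/funext => -[T AT]; apply/eqP; rewrite eqn_leq /hom_vector /=.
rewrite (hom_count_le AT hM hN thMN) (hom_count_le AT hN hM)// => phi /thMN.
by move=> [? ?]; split.
Qed.
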